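(* Let $a,b,y$ be real numbers. The following hold. (1) If $1\leq y\leq 2$ and $1\leq a<b\leq 2$, then $$B(b+1,y)\geq B(a+1,y) +\frac{1}{8\ln\left(\frac{3}{2}\right)}\left(\frac{5}{9}\right)^{y-1}\left[\left(\frac{4}{9}\right)^{b-1}-\left(\frac{4}{9}\right)^{a-1}\right].$$ (2) If ($y>2$ and $0<a<b\leq 1$) or ($0<y<1$ and $2\leq a<b$), then $$B(b+1,y)\leq B(a+1,y) +\frac{1}{8\ln\left(\frac{3}{2}\right)}\left(\frac{5}{9}\right)^{y-1}\left[\left(\frac{4}{9}\right)^{b-1}-\left(\frac{4}{9}\right)^{a-1}\right].$$
   Context: For real $x,y>0$, $B(x,y)=\int_0^1 t^{x-1}(1-t)^{y-1}\,dt$ denotes the (Euler) beta function. *)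

(* Defs.v *)
From mathcomp Require Import all_boot all_order all_algebra.
From mathcomp Require Import all_classical all_reals all_analysis.

Set Implicit Arguments.
Unset Strict Implicit.
Unset Printing Implicit Defensive.

Import Order.TTheory GRing.Theory Num.Theory.
Import numFieldNormedType.Exports.

Local Open Scope classical_set_scope.
Local Open Scope ring_scope.

(* Euler's beta function with real parameters; the library's beta_fun only
   takes natural numbers.  The integral is finite exactly when 0 < x and 0 < y;
   outside that range the real-valued integral is 0 by convention.  The value
   of powR at base 0 only affects the two endpoints, a null set. *)
Definition euler_beta (R : realType) (x y : R) : R :=
  \int[@lebesgue_measure R]_(t in `[0, 1]) (t `^ (x - 1) * (1 - t) `^ (y - 1)).

(* Main.v *)
Require Import Defs.
From mathcomp Require Import all_boot all_order all_algebra.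
From mathcomp Require Import all_classical all_reals all_analysis.
From mathcomp Require Import measurable_realfun ring lra.

Import Order.TTheory GRing.Theory Num.Theory.
Import numFieldNormedType.Exports.

Local Open Scope ring_scope.

(** Write [m = 4 / 9], [q = y - 1].  The density [- 4 * t * ln t] on [0, 1] is a
    probability density with mean [m].  Since [d/ds t ^ s = t * ln t * t ^ (s - 1)],
    the increment [t ^ b * (1 - t) ^ q - t ^ a * (1 - t) ^ q] is the integral over
    [s] in [a, b] of [t * ln t] times the kernel [t ^ (s - 1) * (1 - t) ^ q].  In
    the given parameter ranges this kernel lies on one side of its tangent line in
    [t] at [m] (multiply Bernoulli's inequalities for the two factors).  Replacing
    it by the tangent bounds the increment by [t * ln t] times an affine function
    [C + S * (t - m)], with [C] and [S] independent of [t]; integrating over [t],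
    the slope term vanishes and [C] gives the stated bound. *)

(** * Bernoulli inequalities for real exponents *)

(** Combine [ln x <= x - 1], reversed by [p <= 0], with [1 + u <= expR u]. *)
Lemma powR_ge_tangent_le0 (R : realType) (p x : R) :
  p <= 0 -> 0 < x -> 1 + p * (x - 1) <= x `^ p.
Proof.
move=> p0 x0; rewrite /powR gt_eqF//.
apply: le_trans (expR_ge1Dx _); rewrite lerD2l ler_wnM2l//.
by have := @le_ln1Dx R (x - 1); rewrite subrKC; apply; lra.
Qed.

(** Writing [x ^ p = x * (1 / x) ^ (1 - p)] makes the exponent nonpositive. *)
Lemma powR_ge_tangent_ge1 (R : realType) (p x : R) :
  1 <= p -> 0 < x -> 1 + p * (x - 1) <= x `^ p.
Proof.
move=> p1 x0.
have xE : x `^ p = x * x^-1 `^ (1 - p).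
  rewrite -powR_inv1 ?ltW// -powRrM -{2}(powRr1 (ltW x0)) -powRD.
    by congr (_ `^ _); ring.
  by rewrite (gt_eqF x0) implybT.
rewrite xE -ler_pdivrMl//.
have -> : x^-1 * (1 + p * (x - 1)) = 1 + (1 - p) * (x^-1 - 1).
  by field; rewrite gt_eqF.
by apply: powR_ge_tangent_le0; [lra|rewrite invr_gt0].
Qed.

(** For [p > 0], this is the previous inequality with exponent [1 / p] at the point [x ^ p]. *)
Lemma powR_le_tangent (R : realType) (p x : R) :
  0 <= p <= 1 -> 0 < x -> x `^ p <= 1 + p * (x - 1).
Proof.
move=> /andP[]; rewrite le_eqVlt => /predU1P[<- _ _|p0 p1 x0].
  by rewrite powRr0 mul0r addr0.
have := @powR_ge_tangent_ge1 R p^-1 (x `^ p).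
rewrite -powRrM mulfV ?gt_eqF// powRr1 ?(ltW x0)//.
move=> /(_ (ltac:(by rewrite invf_ge1)) (powR_gt0 _ x0)).
rewrite -(ler_pM2l p0).
have -> : p * (1 + p^-1 * (x `^ p - 1)) = p + (x `^ p - 1).
  by field; rewrite gt_eqF.
lra.
Qed.

(** If both lower bounds are nonnegative they can be multiplied. If one is negative, the sign of
    [l1 * l2] makes the other [l] nonpositive, so the left side is negative. *)
Lemma mul_ge_tangent (R : realDomainType) (A B l1 l2 : R) :
  0 <= A -> 0 <= B -> 1 + l1 <= A -> 1 + l2 <= B -> 0 <= l1 * l2 ->
  1 + l1 + l2 <= A * B.
Proof.
move=> A0 B0 lA lB l12; have AB0 := mulr_ge0 A0 B0.
have [h1|h1] := ltP (1 + l1) 0.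
  have : l2 <= 0 by rewrite -(nmulr_rge0 l2 (_ : l1 < 0))//; lra.
  by move=> ?; lra.
have [h2|h2] := ltP (1 + l2) 0.
  have : l1 <= 0 by rewrite -(nmulr_lge0 l1 (_ : l2 < 0))//; lra.
  by move=> ?; lra.
by apply: le_trans (ler_pM h1 h2 lA lB); lra.
Qed.

Lemma mul_le_tangent (R : realDomainType) (A B l1 l2 : R) :
  0 <= A -> 0 <= B -> A <= 1 + l1 -> B <= 1 + l2 -> l1 * l2 <= 0 ->
  A * B <= 1 + l1 + l2.
Proof.
move=> A0 B0 lA lB l12; apply: le_trans (ler_pM A0 B0 lA lB) _; lra.
Qed.

(** * Tangent line bounds for the beta kernel *)

Section beta_kernel_tangent.
Context {R : realType}.
Variables m t : R.
Hypotheses (m0 : 0 < m) (m1 : m < 1) (t0 : 0 < t) (t1 : t < 1).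

Let powR_scale (x y p : R) : 0 < x -> 0 < y -> x `^ p = y `^ p * (x / y) `^ p.
Proof.
move=> x0 y0; rewrite -powRM ?ltW// ?divr_gt0//.
by rewrite mulrCA mulfV ?gt_eqF// mulr1.
Qed.

Let tangentE (p q : R) :
  1 + (p / m - q / (1 - m)) * (t - m) =
  1 + p * (t / m - 1) + q * ((1 - t) / (1 - m) - 1).
Proof. by field; rewrite subr_eq0 !gt_eqF. Qed.

(** The relative increments of [t] and [1 - t] from [m] and [1 - m] have opposite signs. *)
Let cross_le0 (p q : R) : 0 <= p * q ->
  p * (t / m - 1) * (q * ((1 - t) / (1 - m) - 1)) <= 0.
Proof.
move=> pq.
have -> : p * (t / m - 1) * (q * ((1 - t) / (1 - m) - 1)) =
          - (p * q * ((t - m) ^+ 2 / (m * (1 - m)))).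
  by field; rewrite subr_eq0 !gt_eqF.
rewrite oppr_le0 mulr_ge0// divr_ge0 ?sqr_ge0// mulr_ge0 ?subr_ge0 ?ltW//.
Qed.

Lemma beta_kernel_le_tangent (p q : R) : 0 <= p <= 1 -> 0 <= q <= 1 ->
  t `^ p * (1 - t) `^ q <=
  m `^ p * (1 - m) `^ q * (1 + (p / m - q / (1 - m)) * (t - m)).
Proof.
move=> p01 q01; rewrite (powR_scale t m p)//
  (powR_scale (1 - t) (1 - m) q) ?subr_gt0//.
rewrite mulrACA ler_wpM2l ?mulr_ge0 ?powR_ge0// tangentE.
apply: mul_le_tangent; rewrite ?powR_ge0//.
- by rewrite powR_le_tangent// divr_gt0.
- by rewrite powR_le_tangent// divr_gt0 ?subr_gt0.
- by apply: cross_le0; rewrite mulr_ge0; lra.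
Qed.

Lemma beta_kernel_ge_tangent (p q : R) :
  (p <= 0 /\ 1 <= q) \/ (1 <= p /\ q <= 0) ->
  m `^ p * (1 - m) `^ q * (1 + (p / m - q / (1 - m)) * (t - m)) <=
  t `^ p * (1 - t) `^ q.
Proof.
move=> pq; rewrite (powR_scale t m p)//
  (powR_scale (1 - t) (1 - m) q) ?subr_gt0//.
rewrite [leRHS]mulrACA ler_wpM2l ?mulr_ge0 ?powR_ge0// tangentE.
have tm : 0 < t / m by rewrite divr_gt0.
have tm' : 0 < (1 - t) / (1 - m) by rewrite divr_gt0 ?subr_gt0.
apply: mul_ge_tangent; rewrite ?powR_ge0//.
- by case: pq => -[p0 q1];
    [exact: powR_ge_tangent_le0|exact: powR_ge_tangent_ge1].
- by case: pq => -[p0 q1];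
    [exact: powR_ge_tangent_ge1|exact: powR_ge_tangent_le0].
(* Here [p * q <= 0], so the cross term estimate is used with [- p] in place of [p]. *)
- rewrite -oppr_le0 -mulNr -mulNr; apply: cross_le0.
  rewrite mulNr oppr_ge0; case: pq => -[p0 q1].
    by rewrite mulr_le0_ge0//; lra.
  by rewrite mulr_ge0_le0//; lra.
Qed.

End beta_kernel_tangent.

(** * Integration over the exponent *)

Section exponent_integration.
Context {R : realType}.
Variables m q t : R.
Hypotheses (m0 : 0 < m) (m1 : m < 1) (t0 : 0 < t) (t1 : t < 1).

(* Antiderivatives in [s] of the value and of the slope at [m] of the tangent line
   to [t `^ (s - 1) * (1 - t) `^ q]. *)
Definition tangent_cst (s : R) := (1 - m) `^ q * (m `^ (s - 1) / ln m).

Definition tangent_slope (s : R) :=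
  tangent_cst s * ((s - 1 - (ln m)^-1) / m - q / (1 - m)).

(** Monotonicity of [D] in [s] takes the place of an integral over [s]: its derivative is
    [- (t * ln t) >= 0] times the tangent minus the kernel. *)
Let D (s : R) := t `^ s * (1 - t) `^ q -
  t * ln t * (tangent_cst s + tangent_slope s * (t - m)).

Let lnm0 : ln m != 0.
Proof. by rewrite ln_eq0// lt_eqF. Qed.

Let is_derive_D (s : R) : is_derive s 1 D (- (t * ln t) *
  (m `^ (s - 1) * (1 - m) `^ q * (1 + ((s - 1) / m - q / (1 - m)) * (t - m))
   - t `^ (s - 1) * (1 - t) `^ q)).
Proof.
rewrite /D /tangent_slope /tangent_cst /powR !gt_eqF ?subr_gt0//.
apply: is_derive_eq.
rewrite /GRing.scale/=.
(* Both sides must involve the same power [t ^ (s - 1)] before [field] applies. *)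
rewrite (_ : expR (s * ln t) = t * expR ((s - 1) * ln t)); last first.
  by rewrite mulrBl mul1r expRB lnK ?posrE//; field; rewrite gt_eqF.
field.
by rewrite lnm0 subr_eq0 !gt_eqF.
Qed.

Let sign : 0 <= - (t * ln t).
Proof. by rewrite oppr_ge0 mulr_ge0_le0 ?ln_le0// ltW. Qed.

Lemma beta_kernel_increment_ge (a b : R) : a < b ->
  (forall s, s \in `]a, b[ -> t `^ (s - 1) * (1 - t) `^ q <=
    m `^ (s - 1) * (1 - m) `^ q * (1 + ((s - 1) / m - q / (1 - m)) * (t - m))) ->
  t * ln t * (tangent_cst b - tangent_cst a +
              (tangent_slope b - tangent_slope a) * (t - m)) <=
  t `^ b * (1 - t) `^ q - t `^ a * (1 - t) `^ q.
Proof.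
move=> ab H.
suff : D a <= D b by rewrite /D; lra.
have dD s : derivable D s 1 by exact: ex_derive.
apply: (@ger0_derive1_le_cc R D a b); rewrite ?in_itv/= ?lexx ?ltW//.
- move=> s sab; rewrite derive1E; have [_ ->] := is_derive_D s.
  by rewrite mulr_ge0// subr_ge0; exact: H.
- by apply: derivable_within_continuous => s _.
Qed.

Lemma beta_kernel_increment_le (a b : R) : a < b ->
  (forall s, s \in `]a, b[ ->
    m `^ (s - 1) * (1 - m) `^ q * (1 + ((s - 1) / m - q / (1 - m)) * (t - m)) <=
    t `^ (s - 1) * (1 - t) `^ q) ->
  t `^ b * (1 - t) `^ q - t `^ a * (1 - t) `^ q <=
  t * ln t * (tangent_cst b - tangent_cst a +
              (tangent_slope b - tangent_slope a) * (t - m)).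
Proof.
move=> ab H.
suff : D b <= D a by rewrite /D; lra.
have dD s : derivable D s 1 by exact: ex_derive.
apply: (@ler0_derive1_le_cc R D a b); rewrite ?in_itv/= ?lexx ?ltW//.
- move=> s sab; rewrite derive1E; have [_ ->] := is_derive_D s.
  by rewrite mulr_ge0_le0// subr_le0; exact: H.
- by apply: derivable_within_continuous => s _.
Qed.

End exponent_integration.

(** * Moments of [x * ln x] and integrability of powers of [1 - x] *)

Section beta_integrals.
Context {R : realType}.
Notation mu := (@lebesgue_measure R).
Local Open Scope classical_set_scope.

(** With [u] the square root of [x], [- ln u <= 1 / u] gives [|x * ln x| <= 2 * u]. *)
Lemma cvg_mul_ln_at_right0 : (x * ln x) @[x --> (0 : R)^'+] --> (0 : R).
Proof.
apply/cvgr0Pnorm_le => e e0.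
have h : x `^ 2^-1 @[x --> (0 : R)^'+] --> (0 : R) by apply: powR_cvg0; lra.
have e20 : 0 < e / 2 by lra.
move/cvgr0Pnorm_le : h => /(_ _ e20) h.
near=> x.
have x0 : 0 < x by near: x; exact: nbhs_right_gt.
have x1 : x < 1 by near: x; exact: nbhs_right_lt.
have ue : `|x `^ 2^-1| <= e / 2 by near: x; exact: h.
set u := x `^ 2^-1 in ue.
have u0 : 0 < u by exact: powR_gt0.
have xE : x = u * u.
  by rewrite -powRD ?(gt_eqF x0) ?implybT// (_ : 2^-1 + 2^-1 = 1)
    ?powRr1 ?ltW//; field.
have lnu : - ln u <= u^-1.
  by rewrite -lnV ?posrE// ltW// ln_sublinear// invr_gt0.
have u1 : ln u <= 0.
  by rewrite ln_powR mulr_ge0_le0// ln_le0// ltW.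
rewrite ger0_norm ?(ltW u0)// in ue.
rewrite xE lnM ?posrE// ler0_norm; last first.
  by rewrite mulr_ge0_le0 ?mulr_ge0 ?(ltW u0)//; lra.
have : u * (u * - ln u) <= u * (u * u^-1).
  by rewrite !ler_pM2l.
rewrite mulfV ?gt_eqF// => ?; lra.
Unshelve. all: by end_near. Qed.

Lemma cvg_expr_ln_at_right0 (n : nat) :
  (x ^+ n.+1 * ln x) @[x --> (0 : R)^'+] --> (0 : R).
Proof.
rewrite -[X in _ --> X](mulr0 (0 ^+ n)).
under eq_fun do rewrite exprSr -mulrA.
apply: cvgM; last exact: cvg_mul_ln_at_right0.
apply: cvg_at_right_filter.
exact: exprn_continuous.
Qed.

Lemma within_continuous_expr_ln (n : nat) :
  {within `[0, 1], continuous (fun x : R => x ^+ n.+1 * ln x)}.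
Proof.
apply/continuous_within_itvP => //; split.
- move=> x; rewrite in_itv/= => /andP[x0 x1].
  by apply: cvgM; [exact: exprn_continuous|exact: continuous_ln].
(* At 0 the positive power vanishes, so the value of [ln 0] is immaterial. *)
- by rewrite exprS !mul0r; exact: cvg_expr_ln_at_right0.
- apply: cvg_at_left_filter; apply: cvgM; [exact: exprn_continuous|].
  exact: continuous_ln.
Qed.

Lemma is_derive_expr (n : nat) (x : R) :
  is_derive x 1 (fun x : R => x ^+ n.+1) (n.+1%:R * x ^+ n).
Proof.
split; first exact: exprn_derivable.
by rewrite exp_derive /GRing.scale/= mulr1.
Qed.

(** Obtained from [x ^ (n + 1) * ln x] by parts. *)
Let expr_ln_primitive (n : nat) (x : R) :=
  n.+2%:R^-1 * (x ^+ n.+2 * ln x) - (n.+2%:R ^+ 2)^-1 * x ^+ n.+2.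

Let is_derive_expr_ln_primitive (n : nat) (x : R) : 0 < x ->
  is_derive x 1 (expr_ln_primitive n) (x ^+ n.+1 * ln x).
Proof.
move=> x0; have dln := is_derive1_ln x0.
have k0 : n.+2%:R != 0 :> R by rewrite pnatr_eq0.
have dX := is_derive_expr n.+1 x.
have xE : x ^+ n.+2 = x * x ^+ n.+1 by rewrite exprS.
rewrite /expr_ln_primitive.
(* Making the powers opaque keeps unification from unfolding them. *)
set k : R := n.+2%:R in k0 dX *.
set X := (fun x : R => x ^+ n.+2) in dX *.
rewrite -/(X x) in xE.
have -> : (fun x : R => k^-1 * (x ^+ n.+2 * ln x) - (k ^+ 2)^-1 * x ^+ n.+2) =
          (fun x : R => k^-1 * (X x * ln x) - (k ^+ 2)^-1 * X x) by [].
move: (x ^+ n.+1) k X k0 dX xE => z k X k0 dX xE.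
apply: is_derive_eq; rewrite /GRing.scale/= xE.
by field; rewrite k0 gt_eqF.
Qed.

(** The values [- 1 / 4] at [n = 0] and [- 1 / 9] at [n = 1] give the density [- 4 * x * ln x] its
    mass 1 and mean [4 / 9]. *)
Lemma Rintegral_expr_ln (n : nat) :
  \int[mu]_(x in `[0, 1]) (x ^+ n.+1 * ln x) = - (n.+2%:R ^+ 2)^-1.
Proof.
pose F := expr_ln_primitive n.
have dF (x : R) := @is_derive_expr_ln_primitive n x.
have F0 : F 0 = 0.
  by rewrite /F /expr_ln_primitive exprS !mul0r !mulr0 subr0.
have F1 : F 1 = - (n.+2%:R ^+ 2)^-1.
  by rewrite /F /expr_ln_primitive ln1 expr1n !mulr0 sub0r mulr1.
rewrite /Rintegral (@continuous_FTC2 R _ F 0 1)//.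
- by rewrite F0 F1 sube0.
- exact: within_continuous_expr_ln.
- split.
  + move=> x; rewrite in_itv/= => /andP[x0 _].
    by case: (dF _ x0).
  + rewrite F0 -[X in _ --> X](subr0 (0 : R)).
    apply: cvgB.
      rewrite -[X in _ --> X](mulr0 n.+2%:R^-1).
      by apply: cvgM; [exact: cvg_cst|exact: cvg_expr_ln_at_right0].
    rewrite -[X in _ --> X](mulr0 (n.+2%:R ^+ 2)^-1).
    apply: cvgM; first exact: cvg_cst.
    rewrite -[X in _ --> X](expr0n _ n.+2).
    by apply: cvg_at_right_filter; exact: exprn_continuous.
  + apply: cvg_at_left_filter.
    apply: differentiable_continuous; apply/derivable1_diffP.
    by case: (dF _ ltr01).
- move=> x; rewrite in_itv/= => /andP[x0 _].
  by have := dF _ x0 => -[_ <-]; rewrite derive1E.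
Qed.

Lemma integrable_expr_ln (n : nat) :
  mu.-integrable `[0, 1] (EFin \o (fun x : R => x ^+ n.+1 * ln x)).
Proof.
apply: continuous_compact_integrable; first exact: segment_compact.
exact: within_continuous_expr_ln.
Qed.

Lemma is_derive_powR_onem (r x : R) : x < 1 ->
  is_derive x 1 (fun x : R => (1 - x) `^ r) (- (r * (1 - x) `^ (r - 1))).
Proof.
rewrite -subr_gt0 => x1; have dp := is_derive1_powR r x1.
have ds : is_derive x 1 (fun x : R => 1 - x) (-1).
  by apply: is_derive_eq; ring.
apply: is_derive_eq; first exact: (is_derive1_comp (f := @powR R ^~ r)).
by rewrite mulrN1.
Qed.

(** For [q < 0] the function is unbounded near 1, so the integrals over [[0, 1 - e]] are bounded by
    [1 / (q + 1)] uniformly in [e], and monotone convergence concludes. *)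
Lemma integrable_powR_onem (q : R) : -1 < q ->
  mu.-integrable `[0, 1] (EFin \o (fun x : R => (1 - x) `^ q)).
Proof.
move=> q1.
have mf (A : set (measurableTypeR R)) : measurable A ->
    measurable_fun A (fun x : R => (1 - x) `^ q).
  move=> mA; apply: measurable_funTS.
  apply: (measurableT_comp (measurable_powR q)).
  exact: measurable_funB.
apply/integrableP; split; first by apply/measurable_EFinP; apply: mf.
under eq_integral do rewrite /= ger0_norm ?powR_ge0//.
have q0 : 0 < q + 1 by lra.
(* Starting at [n.+2] keeps the right endpoint strictly between 0 and 1. *)
pose I (n : nat) : set R := `[0, 1 - n.+2%:R^-1].
have nE (n : nat) : (0 : R) < (n.+2%:R^-1 : R) < (1 : R).
  apply/andP; split; first by rewrite invr_gt0 ltr0n.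
  by rewrite invf_lt1 ?ltr1n ?ltr0n.
have int_le (e : R) : 0 < e -> e < 1 ->
    (\int[mu]_(x in `[0%R, (1 - e)%R]) ((1 - x) `^ q)%:E <= ((q + 1)^-1)%:E)%E.
  move=> e0 e1.
  pose F (x : R) := - ((q + 1)^-1 * (1 - x) `^ (q + 1)).
  have dF (x : R) : x < 1 -> is_derive x 1 F ((1 - x) `^ q).
    move=> x1; have dp := is_derive_powR_onem (q + 1) x x1; rewrite addrK in dp.
    apply: is_derive_eq; rewrite /GRing.scale/=.
    by field; rewrite gt_eqF.
  have cF (x : R) : x < 1 -> {for x, continuous F}.
    move=> x1; apply: differentiable_continuous; apply/derivable1_diffP.
    by case: (dF _ x1).
  rewrite (@continuous_FTC2 R _ F 0 (1 - e)).
  - rewrite -EFinB lee_fin /F subr0 powR1 mulr1 opprK subKr.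
    by rewrite gerDr oppr_le0 mulr_ge0 ?powR_ge0// invr_ge0 ltW.
  - by rewrite subr_gt0.
  - apply: derivable_within_continuous => x; rewrite in_itv/= => /andP[_ x1].
    have {}x1 : x < 1 by lra.
    by case: (is_derive_powR_onem q x x1).
  - split.
    + move=> x; rewrite in_itv/= => /andP[x0 x1].
      have {}x1 : x < 1 by lra.
      by case: (dF _ x1).
    + by apply: cvg_at_right_filter; exact: cF.
    + by apply: cvg_at_left_filter; apply: cF; lra.
  - move=> x; rewrite in_itv/= => /andP[x0 x1].
    have {}x1 : x < 1 by lra.
    by have := dF _ x1 => -[_ <-]; rewrite derive1E.
have IE : \bigcup_n I n = `[0, 1[.
  apply/seteqP; split => x /=.
    move=> [n _]; rewrite /I/= !in_itv/= => /andP[-> xn].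
    have /andP[n0 _] := nE n.
    by rewrite /= (le_lt_trans xn)// ltrBlDr ltrDl.
  rewrite in_itv/= => /andP[x0 /ltr_add_invr[k kx]]; exists k => //.
  rewrite /I/= in_itv/= x0/=.
  rewrite lerBrDr (le_trans _ (ltW kx))// lerD2l.
  by rewrite lef_pV2 ?posrE ?ltr0n// ler_nat.
rewrite -integral_itv_bndo_bndc; last by apply/measurable_EFinP; apply: mf.
rewrite -IE; apply: (@le_lt_trans _ _ ((q + 1)^-1)%:E); last exact: ltry.
have ndI : nondecreasing_seq I.
  move=> m n mn; rewrite subsetEset; apply: subset_itvl.
  by rewrite bnd_simp lerD2l lerN2 lef_pV2 ?posrE ?ltr0n// ler_nat.
have mI n : measurable (I n : set (measurableTypeR R)) by exact: measurable_itv.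
have mfI n : measurable_fun (I n : set (measurableTypeR R))
    (fun x : R => ((1 - x) `^ q)%:E).
  by apply/measurable_EFinP; apply: mf.
have f0I n x : I n x -> (0 <= ((1 - x) `^ q)%:E)%E.
  by move=> _; rewrite lee_fin powR_ge0.
apply: cvge_to_le
  (@ge0_nondecreasing_set_cvg_integral _ _ _ _ _ mu ndI mI mfI f0I) _.
by apply: nearW => n; have /andP[n0 n1] := nE n; exact: int_le.
Qed.

End beta_integrals.

(** * Integration of the pointwise bounds over [t] *)

Section beta_comparison.
Context {R : realType}.
Notation mu := (@lebesgue_measure R).
Local Open Scope classical_set_scope.

(** Dominated by [(1 - x) ^ q], because [x ^ s <= 1]. *)
Lemma integrable_beta_kernel (s q : R) : 0 <= s -> -1 < q ->
  mu.-integrable `[0, 1] (EFin \o (fun x : R => x `^ s * (1 - x) `^ q)).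
Proof.
move=> s0 q1; apply: le_integrable (integrable_powR_onem q q1) => //.
  apply/measurable_EFinP; apply: measurable_funTS.
  apply: measurable_funM; first exact: measurable_powR.
  apply: (measurableT_comp (measurable_powR q)).
  exact: measurable_funB.
move=> x /=; rewrite in_itv/= => /andP[x0 x1].
rewrite lee_fin !ger0_norm ?mulr_ge0 ?powR_ge0//.
rewrite ler_piMl ?powR_ge0//.
have : x `^ s <= 1 `^ s by rewrite ge0_ler_powR ?nnegrE.
by rewrite powR1.
Qed.

Let weight (C S m x : R) := x * ln x * (C + S * (x - m)).

Let weightE (C S m : R) : weight C S m =
  (fun x => (C - S * m) * (x ^+ 1 * ln x) + S * (x ^+ 2 * ln x)).
Proof. by apply/funext => x; rewrite /weight; ring. Qed.

Let integrable_linear (c : R) (n : nat) :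
  mu.-integrable `[0, 1] (EFin \o (fun x : R => c * (x ^+ n.+1 * ln x))).
Proof. by apply: (integrableZl _ c (integrable_expr_ln n)). Qed.

Let integrable_weight (C S m : R) : mu.-integrable `[0, 1] (EFin \o weight C S m).
Proof.
rewrite weightE.
exact: (integrableD _ (integrable_linear (C - S * m) 0) (integrable_linear S 1)).
Qed.

(** The two contributions of [S], [(4 / 9) / 4] and [- 1 / 9], cancel. *)
Let Rintegral_weight (C S : R) :
  \int[mu]_(x in `[0, 1]) weight C S (4 / 9) x = - (C / 4).
Proof.
rewrite weightE RintegralD// !RintegralZl//; try exact: integrable_expr_ln.
by rewrite !Rintegral_expr_ln; field.
Qed.

Let kernel_diff0 (a b q : R) : 0 < a -> 0 < b ->
  0 `^ b * (1 - 0) `^ q - 0 `^ a * (1 - 0) `^ q = 0.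
Proof. by move=> a0 b0; rewrite !powR0 ?gt_eqF// !mul0r subr0. Qed.

Let kernel_diff1 (a b q : R) :
  1 `^ b * (1 - 1) `^ q - 1 `^ a * (1 - 1) `^ q = 0.
Proof. by rewrite !powR1 subrr. Qed.

(** The tangent bounds hold on the open interval; at 0 and 1 both sides of the comparison are 0. *)
Let extend_endpoints (P : R -> Prop) : P 0 -> P 1 ->
  (forall x, 0 < x -> x < 1 -> P x) -> forall x, `[0, 1] x -> P x.
Proof.
move=> P0 P1 P01 x; rewrite /= in_itv/= => /andP[].
rewrite le_eqVlt => /predU1P[<-//|x0]; rewrite le_eqVlt => /predU1P[->//|x1].
exact: P01.
Qed.

Lemma euler_beta_increment_ge (a b y C S : R) : 0 < a -> 0 < b -> 0 < y ->
  (forall t, 0 < t -> t < 1 ->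
    t * ln t * (C + S * (t - 4 / 9)) <=
    t `^ b * (1 - t) `^ (y - 1) - t `^ a * (1 - t) `^ (y - 1)) ->
  - (C / 4) <= euler_beta (b + 1) y - euler_beta (a + 1) y.
Proof.
move=> a0 b0 y0 H; have y1 : -1 < y - 1 by lra.
have ia := integrable_beta_kernel _ _ (ltW a0) y1.
have ib := integrable_beta_kernel _ _ (ltW b0) y1.
rewrite /euler_beta !addrK -RintegralB// -(Rintegral_weight C S).
apply: le_Rintegral => //; first exact: (integrableB _ ib ia).
apply: extend_endpoints => //.
- by rewrite kernel_diff0// /weight !mul0r.
- by rewrite kernel_diff1 /weight ln1 mulr0 mul0r.
Qed.

Lemma euler_beta_increment_le (a b y C S : R) : 0 < a -> 0 < b -> 0 < y ->
  (forall t, 0 < t -> t < 1 ->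
    t `^ b * (1 - t) `^ (y - 1) - t `^ a * (1 - t) `^ (y - 1) <=
    t * ln t * (C + S * (t - 4 / 9))) ->
  euler_beta (b + 1) y - euler_beta (a + 1) y <= - (C / 4).
Proof.
move=> a0 b0 y0 H; have y1 : -1 < y - 1 by lra.
have ia := integrable_beta_kernel _ _ (ltW a0) y1.
have ib := integrable_beta_kernel _ _ (ltW b0) y1.
rewrite /euler_beta !addrK -RintegralB// -(Rintegral_weight C S).
apply: le_Rintegral => //; first exact: (integrableB _ ib ia).
apply: extend_endpoints => //.
- by rewrite kernel_diff0// /weight !mul0r.
- by rewrite kernel_diff1 /weight ln1 mulr0 mul0r.
Qed.

End beta_comparison.

(** * The explicit constant and the conclusion *)

(** Since [4 / 9 = (2 / 3) ^ 2], [- 4 * ln (4 / 9) = 8 * ln (3 / 2)]. *)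
Lemma increment_bound_tangent_cst (R : realType) (a b y : R) :
  1 / (8 * ln (3 / 2)) * (5 / 9) `^ (y - 1) *
    ((4 / 9) `^ (b - 1) - (4 / 9) `^ (a - 1)) =
  - ((tangent_cst (4 / 9) (y - 1) b - tangent_cst (4 / 9) (y - 1) a) / 4).
Proof.
have l0 : 0 < ln (3 / 2 : R) by apply: ln_gt0; lra.
rewrite /tangent_cst.
have -> : ln (4 / 9 : R) = - (2 * ln (3 / 2)).
  rewrite (_ : 4 / 9 = ((3 / 2) ^+ 2)^-1); last by field.
  have p0 : 0 < 3 / 2 :> R by lra.
  by rewrite lnV ?posrE ?exprn_gt0// lnXn//; ring.
have -> : 1 - 4 / 9 = 5 / 9 :> R by field.
by field; rewrite gt_eqF.
Qed.

Theorem theorem2p17 (R : realType) (a b y : R) :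
  (1 <= y <= 2 -> 1 <= a -> a < b -> b <= 2 ->
     euler_beta (b + 1) y >=
       euler_beta (a + 1) y +
       1 / (8 * ln (3 / 2)) * (5 / 9) `^ (y - 1) *
         ((4 / 9) `^ (b - 1) - (4 / 9) `^ (a - 1)))
  /\
  ((2 < y /\ 0 < a /\ a < b /\ b <= 1) \/ (0 < y < 1 /\ 2 <= a /\ a < b) ->
     euler_beta (b + 1) y <=
       euler_beta (a + 1) y +
       1 / (8 * ln (3 / 2)) * (5 / 9) `^ (y - 1) *
         ((4 / 9) `^ (b - 1) - (4 / 9) `^ (a - 1))).
Proof.
have m0 : 0 < 4 / 9 :> R by lra.
have m1 : 4 / 9 < 1 :> R by lra.
rewrite increment_bound_tangent_cst; split.
  move=> /andP[y1 y2] a1 ab b2; rewrite -lerBrDl.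
  apply: euler_beta_increment_ge; [lra|lra|lra|move=> t t0 t1].
  apply: beta_kernel_increment_ge => // s; rewrite in_itv/= => /andP[sa sb].
  (* Both exponents [s - 1] and [y - 1] lie in [[0, 1]]. *)
  by apply: beta_kernel_le_tangent => //; lra.
move=> H; have ab : a < b by case: H => [[_ [_ []]]|[_ []]].
have a0 : 0 < a by case: H => [[_ []]//|[_ []]]; lra.
have y0 : 0 < y by case: H => [[]|[/andP[]]//]; lra.
rewrite -lerBlDl; apply: euler_beta_increment_le => //; first lra.
move=> t t0 t1.
apply: beta_kernel_increment_le => // s; rewrite in_itv/= => /andP[sa sb].
apply: beta_kernel_ge_tangent => //.
(* Either [s - 1 <= 0] and [y - 1 >= 1], or [s - 1 >= 1] and [y - 1 <= 0]. *)
by case: H => [[y2 [_ [_ b1]]]|[/andP[_ y1] [a2 _]]]; [left|right]; lra.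
Qed.
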